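(* Let $\mathcal{G}$ be a locally convex topological $\widetilde{\mathbb{C}}$-module with a web of type $\mathcal{C}$ and let $\mathcal{F}$ be a Hausdorff ultrabornological $\widetilde{\mathbb{C}}$-module. Then every sequentially closed $\widetilde{\mathbb{C}}$-linear map $T$ of $\mathcal{G}$ onto $\mathcal{F}$ is open.
   Context: A map is sequentially closed if its graph is sequentially closed in the product space $\mathcal{G}\times\mathcal{F}$. Generalized numbers: $\widetilde{\mathbb{C}}=\mathcal{E}_M/\mathcal{N}$, where $\mathcal{E}_M$ is the ring of nets $(c_\varepsilon)_\varepsilon\in\mathbb{C}^{(0,1]}$ with $|c_\varepsilon|=O(\varepsilon^{-N})$ as $\varepsilon\to0$ for some $N\in\mathbb{N}$, and $\mathcal{N}$ is the ideal of nets with $|c_\varepsilon|=O(\varepsilon^{q})$ for all $q\in\mathbb{N}$; $[(c_\varepsilon)_\varepsilon]$ denotes the class of $(c_\varepsilon)_\varepsilon$. The valuation is $\mathrm{v}(c)=\sup\{b\in\mathbb{R}: |c_\varepsilon|=O(\varepsilon^b)\text{ as }\varepsilon\to0\}$ and $|c|_{\mathrm e}=e^{-\mathrm{v}(c)}$; $\widetilde{\mathbb{C}}$ carries the topology of the ultrametric $|c-d|_{\mathrm e}$. A topological $\widetilde{\mathbb{C}}$-module is a $\widetilde{\mathbb{C}}$-module with a topology making addition and scalar multiplication $\widetilde{\mathbb{C}}\times\mathcal{G}\to\mathcal{G}$ continuous. A subset $A$ of a $\widetilde{\mathbb{C}}$-module is balanced if $\lambda A\subseteq A$ whenever $|\lambda|_{\mathrm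 e}\le1$; convex if $A+A\subseteq A$ and $[(\varepsilon^b)_\varepsilon]A\subseteq A$ for all $b\ge0$; absolutely convex if balanced and convex. A topological $\widetilde{\mathbb{C}}$-module is locally convex if it has a base of convex neighborhoods of $0$. A set $A$ absorbs a set $B$ if there is $a\in\mathbb{R}$ with $B\subseteq[(\varepsilon^b)_\varepsilon]A$ for all $b\le a$; a set is bounded if it is absorbed by every neighborhood of $0$. A disk is a nonempty, balanced and convex set $A\subseteq\mathcal{F}$. For a disk $A$ let $\mathcal{F}_A=\bigcup_{n\in\mathbb{N}}[(\varepsilon^{-n})_\varepsilon]A$, and for $u\in\mathcal{F}_A$ let $\mathrm{v}_A(u)=\sup\{b\in\mathbb{R}:u\in[(\varepsilon^b)_\varepsilon]A\}$ and $\mathcal{P}_A(u)=e^{-\mathrm{v}_A(u)}$. $A$ is a Banach disk if $(\mathcal{F}_A,\mathcal{P}_A)$ is a Banach $\widetilde{\mathbb{C}}$-module, i.e. $\mathcal{P}_A(u)=0$ only for $u=0$ and $\mathcal{F}_A$ is complete for the metric $\mathcal{P}_A(u-v)$. A subset of a locally convex topological $\widetilde{\mathbb{C}}$-module $\mathcal{F}$ is ultrabornivorous if it absorbs every bounded Banach disk of $\mathcal{F}$; $\mathcal{F}$ is ultrabornological if it is a locally convex topological $\widetilde{\mathbb{C}}$-module in which every absolutely convex ultrabornivorous subset is a neighborhood of $0$. A web on a locally convex topological $\widetilde{\mathbb{C}}$-module $\mathcal{G}$ is a family $\mathcal{W}=\{C(n_1,\dots,n_k)\}$ of subsets of $\mathcal{G}$,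 with $k,n_1,\dots,n_k$ running through $\mathbb{N}\setminus0$, such that $\mathcal{G}=\bigcup_{n_1\ge1}C(n_1)$ and $C(n_1,\dots,n_{k-1})=\bigcup_{n_k\ge1}C(n_1,\dots,n_k)$ for all $k>1$ and all $n_1,\dots,n_{k-1}$. It is of type $\mathcal{C}$ if for every sequence $(n_k)_{k\ge1}$ in $\mathbb{N}\setminus0$ there is a sequence $(\rho_k)_{k\ge1}$ in $\mathbb{R}$ such that for all $\lambda_k\ge\rho_k$ and all $x_k\in C(n_1,\dots,n_k)$ ($k\ge1$) the series $\sum_{k=1}^\infty[(\varepsilon^{\lambda_k})_\varepsilon]x_k$ converges in $\mathcal{G}$. *)

(* Defs.v *)
From HB Require Import structures.
From mathcomp Require Import all_boot all_order all_algebra.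
From mathcomp Require Import all_classical topology.
From mathcomp Require Import pseudometric_normed_Zmodule.

Set Implicit Arguments.
Unset Strict Implicit.
Unset Printing Implicit Defensive.

Import Order.TTheory GRing.Theory Num.Theory.

Local Open Scope classical_set_scope.
Local Open Scope ring_scope.

(* [topologicalLmodType] of tvs requires a [numDomainType] of scalars, which the
   ring of generalized numbers is not. HB refuses to declare a more general
   structure once tvs is loaded, whence the position of these declarations. *)

#[short(type="preTopologicalNzRingType")]
HB.structure Definition PreTopologicalNzRing :=
  {K of Topological K & GRing.NzRing K}.

HB.mixin Record isTopologicalGmodule (K : preTopologicalNzRingType) M
    & Topological M & GRing.Lmodule K M := {
  gmod_add_continuous : continuous (fun z : M * M => z.1 + z.2) ;
  gmod_scale_continuous : continuous (fun z : K * M => z.1 *: z.2) ;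
}.

#[short(type="topologicalGmodType")]
HB.structure Definition TopologicalGmodule (K : preTopologicalNzRingType) :=
  {M of Topological M & GRing.Lmodule K M & isTopologicalGmodule K M}.

From mathcomp Require Import all_reals all_analysis.
From mathcomp Require Import complex.

Import ComplexField.Normc.

Definition eps01 (R : realType) : Type := {e : R | 0 < e <= 1}.

Section Eps01.
Variable R : realType.

HB.instance Definition _ := Choice.on (eps01 R).

Lemma eps01_one_subproof : 0 < (1 : R) <= 1.
Proof. by rewrite ltr01 lexx. Qed.

HB.instance Definition _ :=
  isPointed.Build (eps01 R) (exist _ (1 : R) eps01_one_subproof).

Lemma eps01_gt0 (e : eps01 R) : 0 < sval e.
Proof. by case: e => e /= /andP[]. Qed.

Lemma eps01_le1 (e : eps01 R) : sval e <= 1.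
Proof. by case: e => e /= /andP[]. Qed.

End Eps01.

Notation net R := (eps01 R -> R[i]).

Section Nets.
Variable R : realType.
Implicit Types (c d : net R) (a b : R).

Definition is_bigO c b : Prop :=
  exists M : R, exists2 eta : R, 0 < eta &
    forall e : eps01 R, sval e < eta -> normc (c e) <= M * sval e `^ b.

Lemma normc_ge0 (z : R[i]) : 0 <= normc z.
Proof. by case: z => x y; exact: sqrtr_ge0. Qed.

Lemma is_bigO_le c a b : a <= b -> is_bigO c b -> is_bigO c a.
Proof.
move=> ab [M [eta eta0 H]]; exists `|M|, eta => // e /H/le_trans; apply.
apply: (le_trans (ler_wpM2r (powR_ge0 _ _) (ler_norm M))).
by apply: ler_wpM2l => //; apply: ger_powR; rewrite // eps01_gt0 eps01_le1.
Qed.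

Lemma is_bigO_cst (z : R[i]) : is_bigO (cst z) 0.
Proof. by exists (normc z), 1 => // e _; rewrite powRr0 mulr1. Qed.

Lemma is_bigO0 b : is_bigO 0 b.
Proof. by exists 0, 1 => // e _; rewrite mul0r normc0. Qed.

Lemma is_bigOD c d b : is_bigO c b -> is_bigO d b -> is_bigO (c + d) b.
Proof.
move=> [M [r r0 HM]] [N [s s0 HN]]; exists (M + N), (Num.min r s).
  by rewrite lt_min r0.
move=> e; rewrite lt_min => /andP[/HM h1 /HN h2].
by rewrite mulrDl (le_trans (le_normcD _ _))// lerD.
Qed.

Lemma is_bigON c b : is_bigO c b -> is_bigO (- c) b.
Proof.
by move=> [M [r r0 HM]]; exists M, r => // e /HM; rewrite -(normcN (c e)).
Qed.

Lemma is_bigOM c d a b : is_bigO c a -> is_bigO d b -> is_bigO (c * d) (a + b).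
Proof.
move=> [M [r r0 HM]] [N [s s0 HN]]; exists (M * N), (Num.min r s).
  by rewrite lt_min r0.
move=> e; rewrite lt_min => /andP[/HM h1 /HN h2].
rewrite powRD; last by apply/implyP => _; rewrite gt_eqF// eps01_gt0.
rewrite mulrACA [(c * d) e]/(c e * d e) normcM.
by apply: ler_pM => //; exact: normc_ge0.
Qed.

Definition moderate : {pred (net R)} :=
  fun c => `[< exists N : nat, is_bigO c (- N%:R) >].

Lemma moderateP c : reflect (exists N : nat, is_bigO c (- N%:R)) (c \in moderate).
Proof. exact: asboolP. Qed.

Lemma moderate_real c b : is_bigO c b -> c \in moderate.
Proof.
move=> h; apply/moderateP; exists (Num.truncn `|b|).+1.
apply: is_bigO_le h; rewrite lerNl.
have := truncnS_gt `|b|.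
by move/ltW; apply: le_trans; rewrite -normrN ler_norm.
Qed.

Lemma moderate_subring : subring_closed moderate.
Proof.
split.
- by apply/moderateP; exists 0%N; rewrite oppr0; exact: is_bigO_cst.
- move=> c d /moderateP[N hN] /moderateP[P hP].
  apply: (@moderate_real _ (- (N + P)%:R)); apply: is_bigOD.
    by apply: is_bigO_le hN; rewrite lerN2 ler_nat leq_addr.
  by apply/is_bigON/(is_bigO_le _ hP); rewrite lerN2 ler_nat leq_addl.
- move=> c d /moderateP[N hN] /moderateP[P hP].
  exact: (moderate_real (is_bigOM hN hP)).
Qed.

HB.instance Definition _ :=
  GRing.isSubringClosed.Build (net R) moderate moderate_subring.

End Nets.

Record moderate_net (R : realType) :=
  ModerateNet { mnet :> net R ; _ : mnet \in @moderate R }.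

Section ModerateNets.
Variable R : realType.

HB.instance Definition _ := [isSub for @mnet R].
HB.instance Definition _ := [Choice of moderate_net R by <:].
HB.instance Definition _ := [SubChoice_isSubComNzRing of moderate_net R by <:].

Definition negligible : {pred (moderate_net R)} :=
  fun c => `[< forall q : nat, is_bigO c q%:R >].

Lemma negligibleP (c : moderate_net R) :
  reflect (forall q : nat, is_bigO c q%:R) (c \in negligible).
Proof. exact: asboolP. Qed.

Lemma negligible_bigO (c : moderate_net R) b : c \in negligible -> is_bigO c b.
Proof.
move=> /negligibleP/(_ (Num.truncn `|b|).+1); apply: is_bigO_le.
by rewrite (le_trans (ler_norm b))// ltW// truncnS_gt.
Qed.

Lemma negligible_ideal : idealr_closed negligible.
Proof.
split.
- by apply/negligibleP => q; exact: is_bigO0.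
- apply/negP => /negligibleP/(_ 1%N)[M [eta eta0 H]].
  have M0 : 0 < 1 + `|M| by rewrite ltr_pwDl.
  pose x : R := Num.min (eta / 2) (Num.min 1 (1 + `|M|)^-1 / 2).
  have x0 : 0 < x by rewrite lt_min !divr_gt0 ?lt_min ?ltr01 ?invr_gt0.
  have x1 : x <= 1.
    rewrite ge_min; apply/orP; right; rewrite ler_pdivrMr// mul1r.
    by rewrite ge_min ler1n.
  have xM : x < (1 + `|M|)^-1.
    rewrite gt_min; apply/orP; right; rewrite ltr_pdivrMr//.
    rewrite (@le_lt_trans _ _ (1 + `|M|)^-1)//; first by rewrite ge_min lexx orbT.
    by rewrite ltr_pMr ?invr_gt0// ltr1n.
  have xE : 0 < x <= 1 by rewrite x0.
  have /H : sval (exist _ x xE : eps01 R) < eta.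
    by rewrite /= gt_min ltr_pdivrMr// ltr_pMr// ltr1n.
  rewrite [(1 : moderate_net R) _]/(1 : R[i]) normc1 /= powRr1 ?(ltW x0)// leNgt.
  rewrite (@le_lt_trans _ _ ((1 + `|M|) * x))//.
    by rewrite ler_wpM2r ?(ltW x0)// (le_trans (ler_norm M))// lerDr.
  by rewrite -ltr_pdivlMl// mulr1.
- move=> a c d hc hd; apply/negligibleP => q.
  case: (a) => a' /= /moderateP[N aN].
  have hac : is_bigO (a' * (c : net R)) (- N%:R + (N%:R + q%:R)).
    by apply: is_bigOM => //; exact: negligible_bigO.
  by rewrite addKr in hac; apply: is_bigOD => //; exact: negligible_bigO.
Qed.

HB.instance Definition _ :=
  isIdealr.Build (moderate_net R) negligible negligible_ideal.

End ModerateNets.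

Definition gennum (R : realType) : Type := {ideal_quot (@negligible R)}.

Section GeneralizedNumbers.
Variable R : realType.

HB.instance Definition _ := GRing.ComNzRing.on (gennum R).

Definition gclass (c : moderate_net R) : gennum R := (\pi_(gennum R) c)%qT.

Definition eps_net (b : R) : net R := fun e => (sval e `^ b)%:C%C.

Lemma eps_net_moderate b : eps_net b \in @moderate R.
Proof.
apply: (@moderate_real _ _ b); exists 1, 1 => // e _.
by rewrite mul1r /= expr0n addr0 sqrtr_sqr ger0_norm ?powR_ge0.
Qed.

Definition eps_pow (b : R) : gennum R :=
  gclass (ModerateNet (eps_net_moderate b)).

Definition net_val (c : net R) : \bar R :=
  ereal_sup [set b%:E | b in [set b : R | is_bigO c b]].

(* The valuation does not depend on the representative: see [gvalE]. *)
Definition gval (x : gennum R) : \bar R := net_val (repr x).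

Definition gabs (x : gennum R) : R := fine (expeR (- gval x)).

End GeneralizedNumbers.

Section GeneralizedNumbersTheory.
Variable R : realType.
Implicit Types (c d : net R) (x y z : gennum R).
Local Open Scope ereal_scope.

Lemma is_bigO_eq c d b :
  is_bigO (c - d)%R b -> is_bigO c b <-> is_bigO d b.
Proof.
move=> h; split => k.
  by rewrite -(subKr c d); apply: is_bigOD => //; exact: is_bigON.
by rewrite -(subrK d c); exact: is_bigOD.
Qed.

Lemma gvalE (c : moderate_net R) : gval (gclass c) = net_val c.
Proof.
have h : (repr (gclass c) - c)%R \in @negligible R.
  by rewrite Quotient.idealrBE reprK.
have H b : is_bigO ((repr (gclass c) : net R) - (c : net R))%R b.
  exact: (@negligible_bigO _ _ b h).
rewrite /gval /net_val; congr ereal_sup; apply/seteqP; split=> _ /= [b hb <-].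
  by exists b => //; apply/(is_bigO_eq (H b)).
by exists b => //; apply/(is_bigO_eq (H b)).
Qed.

Lemma net_val_ge c b : is_bigO c b -> b%:E <= net_val c.
Proof. by move=> h; apply: ereal_sup_ubound; exists b. Qed.

Lemma net_val_lt c b : b%:E < net_val c -> is_bigO c b.
Proof.
move=> /ereal_sup_gt[_ [a ha <-]]; rewrite lte_fin => /ltW ba.
exact: is_bigO_le ha.
Qed.

Lemma gval_gtNy x : -oo < gval x.
Proof.
rewrite /gval; case: (repr x) => c /= /moderateP[N hN].
by apply: (lt_le_trans (ltNyr _) (net_val_ge hN)).
Qed.

Lemma gclass0 : gclass 0%R = 0%R :> gennum R.
Proof. exact: rmorph0. Qed.

Lemma gclassB (c d : moderate_net R) : gclass (c - d)%R = (gclass c - gclass d)%R.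
Proof. exact: rmorphB. Qed.

Lemma gclassD (c d : moderate_net R) : gclass (c + d)%R = (gclass c + gclass d)%R.
Proof. exact: rmorphD. Qed.

Lemma gclass_repr x : gclass (repr x) = x.
Proof. exact: reprK. Qed.

Lemma gvalD x y : mine (gval x) (gval y) <= gval (x + y)%R.
Proof.
rewrite -[in leRHS](gclass_repr x) -[in leRHS](gclass_repr y) -gclassD gvalE.
rewrite /gval; move: (repr x) (repr y) => c d.
rewrite leNgt; apply/negP; rewrite lt_min => /andP[].
move=> /ereal_sup_gt[_ [a ha <-] va] /ereal_sup_gt[_ [b hb <-] vb].
have hc : is_bigO c (Num.min a b) by apply: is_bigO_le ha; rewrite ge_min lexx.
have hd : is_bigO d (Num.min a b).
  by apply: is_bigO_le hb; rewrite ge_min lexx orbT.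
by have := net_val_ge (is_bigOD hc hd); rewrite leNgt EFin_min lt_min va vb.
Qed.

Lemma gvalN x : gval (- x)%R = gval x.
Proof.
suff h y : gval y <= gval (- y)%R.
  by apply/eqP; rewrite eq_le h andbT -[in leRHS](opprK x) h.
have -> : (- y = gclass (- repr y))%R.
  by rewrite -[in LHS](gclass_repr y); apply/esym; exact: rmorphN.
rewrite gvalE; apply: ub_ereal_sup => _ [b hb <-].
by apply: net_val_ge; exact: is_bigON.
Qed.

Lemma gval0 : gval (0 : gennum R)%R = +oo.
Proof.
rewrite -gclass0 gvalE; apply/eqyP => A _; apply: net_val_ge; exact: is_bigO0.
Qed.

Lemma gval_eqy x : gval x = +oo -> x = 0%R.
Proof.
move=> h; rewrite -gclass0.
rewrite -(gclass_repr x); apply/eqP; rewrite -Quotient.idealrBE subr0.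
by apply/negligibleP => q; apply: net_val_lt; rewrite -/(gval x) h ltry.
Qed.

Lemma gabsE x : (gabs x)%:E = expeR (- gval x).
Proof.
rewrite /gabs fineK// ge0_fin_numE ?expeR_ge0// lt_neqAle leey andbT expeR_eqy.
by rewrite eqe_oppLR gt_eqF// gval_gtNy.
Qed.

Lemma gabs_ge0 x : (0 <= gabs x)%R.
Proof. by rewrite -lee_fin gabsE expeR_ge0. Qed.

Lemma gabs0 : gabs (0 : gennum R)%R = 0%R.
Proof. by apply: EFin_inj; rewrite gabsE gval0. Qed.

Lemma gabs0_eq0 x : gabs x = 0%R -> x = 0%R.
Proof.
move=> h; have : expeR (- gval x) == 0 by rewrite -gabsE h.
rewrite expeR_eq0.
by rewrite eqe_oppLR => /eqP; exact: gval_eqy.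
Qed.

Lemma gabsN x : gabs (- x)%R = gabs x.
Proof. by rewrite /gabs gvalN. Qed.

Lemma gabsD x y : (gabs (x + y) <= Num.max (gabs x) (gabs y))%R.
Proof.
rewrite -lee_fin EFin_max !gabsE le_max !lee_expeR !leeN2 -ge_min.
exact: gvalD.
Qed.

End GeneralizedNumbersTheory.

Section GeneralizedNumbersMetric.
Variable R : realType.
Implicit Types x y z : gennum R.

Lemma gdistxx x : gabs (x - x) = 0.
Proof. by rewrite subrr gabs0. Qed.

Lemma gdist_positivity x y : gabs (x - y) = 0 -> x = y.
Proof. by move/gabs0_eq0 => h; apply/eqP; rewrite -subr_eq0 h. Qed.

Lemma gdist_sym x y : gabs (x - y) = gabs (y - x).
Proof. by rewrite -opprB gabsN. Qed.

Lemma gdist_triangle y x z : gabs (x - z) <= gabs (x - y) + gabs (y - z).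
Proof.
have -> : x - z = (x - y) + (y - z) by rewrite addrA subrK.
by apply: (le_trans (gabsD _ _)); rewrite ge_max lerDl lerDr !gabs_ge0.
Qed.

HB.instance Definition _ := isMetric.Build R (gennum R)
  gdistxx gdist_positivity gdist_sym gdist_triangle.

End GeneralizedNumbersMetric.

Section Modules.
Variables (R : realType) (G : topologicalGmodType (gennum R)).
Implicit Types (A B U V : set G) (u : G) (b : R).

Definition scale_set (l : gennum R) A : set G := [set l *: x | x in A].

Definition balanced A :=
  forall l : gennum R, gabs l <= 1 -> scale_set l A `<=` A.

Definition gconvex A :=
  [set x + y | x in A & y in A] `<=` A /\
  forall b, 0 <= b -> scale_set (eps_pow b) A `<=` A.

Definition absolutely_convex A := balanced A /\ gconvex A.

Definition glocally_convex :=
  exists2 B : set_system G,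
    (forall V, B V -> gconvex V /\ nbhs (0 : G) V) &
    (forall U, nbhs (0 : G) U -> exists2 V, B V & V `<=` U).

Definition absorbs A B :=
  exists a : R, forall b, b <= a -> B `<=` scale_set (eps_pow b) A.

Definition gbounded B := forall U, nbhs (0 : G) U -> absorbs U B.

Definition disk A := [/\ A !=set0, balanced A & gconvex A].

Definition disk_span A : set G :=
  \bigcup_(n in [set: nat]) scale_set (eps_pow (- n%:R)) A.

Definition disk_val A u : \bar R :=
  ereal_sup [set b%:E | b in [set b : R | scale_set (eps_pow b) A u]].

(* P_A(u); for a disk A, finite on [disk_span A], which is F_A, and +oo elsewhere. *)
Definition disk_gauge A u : \bar R := expeR (- disk_val A u).

Definition disk_separated A :=
  forall u, disk_span A u -> disk_gauge A u = 0%E -> u = 0.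

Definition disk_complete A :=
  forall x : nat -> G, (forall n, disk_span A (x n)) ->
    (forall r : R, 0 < r -> exists N : nat, forall m n : nat,
       (N <= m)%N -> (N <= n)%N -> (disk_gauge A (x m - x n)%R < r%:E)%E) ->
    exists2 l, disk_span A l &
      forall r : R, 0 < r -> exists N : nat, forall n : nat,
        (N <= n)%N -> (disk_gauge A (x n - l)%R < r%:E)%E.

Definition banach_disk A := [/\ disk A, disk_separated A & disk_complete A].

Definition ultrabornivorous A :=
  forall B, gbounded B -> banach_disk B -> absorbs A B.

Definition ultrabornological :=
  glocally_convex /\
  forall A, absolutely_convex A -> ultrabornivorous A -> nbhs (0 : G) A.

(* [C [:: n1; ...; nk]] is C(n1, ..., nk); only the values of [C] at nonempty
   sequences of positive numbers are relevant. *)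
Definition is_web (C : seq nat -> set G) :=
  [set: G] = \bigcup_(n in [set n : nat | (0 < n)%N]) C [:: n] /\
  forall s : seq nat, s != [::] -> all (fun n => 0 < n)%N s ->
    C s = \bigcup_(n in [set n : nat | (0 < n)%N]) C (rcons s n).

(* The sequences n, rho, lambda and x are indexed from 1: their value at 0 is
   ignored. *)
Definition web_typeC (C : seq nat -> set G) :=
  forall n : nat -> nat, (forall k, (0 < k)%N -> (0 < n k)%N) ->
  exists rho : nat -> R, forall (lambda : nat -> R) (x : nat -> G),
    (forall k, (0 < k)%N -> rho k <= lambda k) ->
    (forall k, (0 < k)%N -> C [seq n i | i <- iota 1 k] (x k)) ->
    exists l : G,
      (\sum_(1 <= k < m.+1) eps_pow (lambda k) *: x k) @[m --> \oo] --> l.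

End Modules.

Definition sequentially_closed (X : topologicalType) (A : set X) :=
  forall (x : nat -> X) (l : X), (forall n, A (x n)) -> x @ \oo --> l -> A l.

Definition sequentially_closed_map (X Y : topologicalType) (f : X -> Y) :=
  sequentially_closed [set z : X * Y | z.2 = f z.1].

Definition open_map (X Y : topologicalType) (f : X -> Y) :=
  forall U : set X, open U -> open (f @` U).

Arguments glocally_convex {R} G.
Arguments ultrabornological {R} G.

(* Main.v *)
Require Import Defs.
From mathcomp Require Import all_boot all_order all_algebra.
From mathcomp Require Import all_classical all_reals all_analysis.
From mathcomp Require Import complex.
From mathcomp Require Import ring lra.

(** The argument is a Baire-category argument run inside each bounded Banach
    disk B of F, in the style of De Wilde.  Write B_s for [(eps^s)] B.

    It is enough to show that T(V) is a neighbourhood of 0 for V in a base of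
    neighbourhoods of 0, and such a base can be made of disks
    ([glocally_convex_disk]).  Then T(V) is absolutely convex, so, F being
    ultrabornological, the task is to show that some B_a lies in T(V)
    ([image_contains_eps_ball]).

    The sets v + B_s are the balls of a complete ultrametric (with infinite
    values) on F, for which F is a Baire space ([disk_Baire]).  Since V is
    absorbent, F is the countable union of the T([(eps^-m)] V), one of which is
    nonmeagre.  Cutting W = [(eps^-m)] V by the successive layers of the web
    gives a branch n_1, n_2, ... such that every T(A_k), where A_k is the
    intersection of W and C(n_1, ..., n_k), is nonmeagre
    ([nonmeagre_branch]); hence T(A_k) is dense in a ball T z_k + B_{s_k} with
    z_k in A_k ([disk_nonmeagre_dense]).

    Choose exponents a_k large enough for the web condition of type C, for
    [(eps^a_k)] W to lie in V, and for a_k + s_k to tend to infinity.  Density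
    lets one write any w in B_{a_1 + s_1}, up to an error in B_{a_2 + s_2}, as
    [(eps^a_1)] (T x_1 - T z_1) with x_1 in A_1, then treat the error in the
    same way, and so on ([disk_dense_approx]).  The series of the
    [(eps^a_k)] x_k and of the [(eps^a_k)] z_k converge in G because the web is
    of type C, and their sums lie in V because V, an open subgroup, is closed;
    the remainders tend to 0 in F because B is bounded.  As the graph of T is
    sequentially closed, w is the image of the difference of the two sums, an
    element of V. *)

Set Implicit Arguments.
Unset Strict Implicit.
Unset Printing Implicit Defensive.

Import Order.TTheory GRing.Theory Num.Theory.

Local Open Scope classical_set_scope.
Local Open Scope ring_scope.

(** * Generalized numbers *)

Section GeneralizedNumbers.
Variable R : realType.
Implicit Types (x y : gennum R) (a b : R).

Lemma eps_powD a b : eps_pow (a + b) = eps_pow a * eps_pow b.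
Proof.
rewrite /eps_pow /gclass -rmorphM; congr (\pi_(gennum R) _)%qT.
apply: val_inj; apply/funext => e.
rewrite [RHS]/(eps_net a e * eps_net b e) /= /eps_net powRD ?rmorphM//.
by apply/implyP => _; rewrite gt_eqF// eps01_gt0.
Qed.

Lemma eps_pow0 : eps_pow 0 = 1 :> gennum R.
Proof.
rewrite /eps_pow /gclass -(rmorph1 (\pi_(gennum R))%qT).
congr (\pi_(gennum R) _)%qT; apply: val_inj; apply/funext => e.
by rewrite /= /eps_net powRr0.
Qed.

(** Inequalities between absolute values become inequalities between
    valuations, which are statements about growth of nets. *)
Lemma gabs_leP x a : gabs x <= expR (- a) <-> (a%:E <= gval x)%E.
Proof.
rewrite -lee_fin gabsE (_ : (expR _)%:E = expeR (- a%:E)%E)//.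
by rewrite lee_expeR leeN2.
Qed.

Lemma gabs_eps_pow a : gabs (eps_pow a : gennum R) <= expR (- a).
Proof.
apply/gabs_leP; rewrite gvalE; apply: net_val_ge.
exists 1, 1 => // e _.
by rewrite mul1r /= expr0n addr0 sqrtr_sqr ger0_norm ?powR_ge0.
Qed.

(** Growth orders of nets add up under products; as the valuation is a supremum
    that need not be attained, the bound is obtained up to every e > 0. *)
Lemma gabsM_le x y a b :
  gabs x <= expR (- a) -> gabs y <= expR (- b) ->
  gabs (x * y) <= expR (- (a + b)).
Proof.
move=> /gabs_leP ax /gabs_leP byy; apply/gabs_leP.
have -> : x * y = gclass (repr x * repr y).
  by rewrite -[in LHS](gclass_repr x) -[in LHS](gclass_repr y) /gclass rmorphM.
rewrite gvalE; apply/lee_subgt0Pr => e e0.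
rewrite -EFinB (_ : a + b - e = (a - e / 2) + (b - e / 2)); last by field.
apply/net_val_ge/is_bigOM; apply: net_val_lt.
  by apply: lt_le_trans ax; rewrite lte_fin; lra.
by apply: lt_le_trans byy; rewrite lte_fin; lra.
Qed.

Lemma gabs1 : gabs (1 : gennum R) <= 1.
Proof. by have := gabs_eps_pow 0; rewrite oppr0 expR0 eps_pow0. Qed.

Lemma gabsM_le1 x y : gabs x <= 1 -> gabs y <= 1 -> gabs (x * y) <= 1.
Proof.
rewrite -expR0 -[X in expR X]oppr0 => hx hy; rewrite -[X in - X](addr0 0).
exact: gabsM_le.
Qed.

(** How neighbourhoods of 0 in the ring of scalars are used: they contain every
    sufficiently small multiple of the unit ball. *)
Lemma gabs_eps_pow_small (d : R) : 0 < d ->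
  exists a, forall x b, gabs x <= 1 -> a <= b -> gabs (x * eps_pow b) < d.
Proof.
move=> d0; exists (1 - ln d) => x b x1 ab.
have xb : gabs (x * eps_pow b) <= expR (- (0 + b)).
  by apply: gabsM_le (gabs_eps_pow b); rewrite oppr0 expR0.
by apply: (le_lt_trans xb); rewrite -[ltRHS](lnK d0) ltr_expR; lra.
Qed.

End GeneralizedNumbers.

(** * Disks and their gauges *)

Section Disks.
Variables (R : realType) (G : topologicalGmodType (gennum R)).
Implicit Types (A B V : set G) (s t : R) (u v : G).

(** As eps^s is invertible, a dilated set is also a preimage, which is the form
    that the algebra below uses. *)
Lemma eps_ballP B s u : scale_set (eps_pow s) B u <-> B (eps_pow (- s) *: u).
Proof.
split=> [[v Bv <-]|Bu].
  by rewrite scalerA -eps_powD addNr eps_pow0 scale1r.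
exists (eps_pow (- s) *: u) => //.
by rewrite scalerA -eps_powD subrr eps_pow0 scale1r.
Qed.

Lemma disk0 B : disk B -> B 0.
Proof.
case=> -[b Bb] bal _; apply: (bal 0); first by rewrite gabs0.
by exists b; rewrite ?scale0r.
Qed.

Lemma diskN B u : disk B -> B u -> B (- u).
Proof.
case=> _ bal _ Bu; apply: (bal (- 1)); first by rewrite gabsN gabs1.
by exists u => //; rewrite scaleN1r.
Qed.

Lemma diskD B u v : disk B -> B u -> B v -> B (u + v).
Proof. by case=> _ _ [BD _] Bu Bv; apply: BD; exists u => //; exists v. Qed.

Lemma diskB B u v : disk B -> B u -> B v -> B (u - v).
Proof. by move=> dB Bu Bv; apply: diskD => //; exact: diskN. Qed.

Lemma disk_sum B (f : nat -> G) m n : disk B ->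
  (forall k, (m <= k)%N -> B (f k)) -> B (\sum_(m <= k < n) f k).
Proof.
move=> dB Bf; rewrite big_nat; apply: (big_ind B); first exact: disk0.
- by move=> *; exact: diskD.
- by move=> k /andP[mk _]; exact: Bf.
Qed.

Lemma disk_eps_ball B s : disk B -> disk (scale_set (eps_pow s) B).
Proof.
move=> dB; have [_ bal [_ cvx]] := dB; split.
- by exists 0; apply/eps_ballP; rewrite scaler0; exact: disk0.
- move=> l l1 _ [v /eps_ballP Bv <-]; apply/eps_ballP.
  apply: (bal l) => //; exists (eps_pow (- s) *: v) => //.
  by rewrite !scalerA mulrC.
- split.
    move=> _ [u /eps_ballP Bu [v /eps_ballP Bv <-]]; apply/eps_ballP.
    by rewrite scalerDr; exact: diskD.
  move=> b b0 _ [v /eps_ballP Bv <-]; apply/eps_ballP.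
  apply: (cvx b) => //; exists (eps_pow (- s) *: v) => //.
  by rewrite !scalerA mulrC.
Qed.

Lemma eps_ball_scale B s t u : scale_set (eps_pow s) B u ->
  scale_set (eps_pow (t + s)) B (eps_pow t *: u).
Proof.
move=> /eps_ballP Bu; apply/eps_ballP.
by rewrite scalerA -eps_powD opprD addrAC addNr add0r.
Qed.

Lemma eps_ball_le B s t : disk B -> s <= t ->
  scale_set (eps_pow t) B `<=` scale_set (eps_pow s) B.
Proof.
move=> [_ _ [_ cvx]] st u /eps_ballP Bu; apply/eps_ballP.
apply: (cvx (t - s)); rewrite ?subr_ge0//; exists (eps_pow (- t) *: u) => //.
by rewrite scalerA -eps_powD addrAC subrr add0r.
Qed.

(** Up to an arbitrarily small loss of radius, the balls of the gauge of B are
    the dilates of B: this lemma and the next one allow all later arguments to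
    speak of dilates only. *)
Lemma disk_gauge_lt B s u : disk B ->
  (disk_gauge B u < (expR (- s))%:E)%E -> scale_set (eps_pow s) B u.
Proof.
move=> dB; rewrite (_ : (expR _)%:E = expeR (- s%:E)%E)// lte_expeR lteN2.
move=> /ereal_sup_gt[_ [b Bb <-]]; rewrite lte_fin => /ltW sb.
exact: eps_ball_le sb _ Bb.
Qed.

Lemma disk_gauge_le B s u : scale_set (eps_pow s) B u ->
  (disk_gauge B u <= (expR (- s))%:E)%E.
Proof.
move=> Bu; rewrite (_ : (expR _)%:E = expeR (- s%:E)%E)// lee_expeR leeN2.
by apply: ereal_sup_ubound; exists s.
Qed.

Lemma disk_gauge_small (r : R) : 0 < r -> exists N : nat, forall B n u,
  disk B -> (N <= n)%N -> scale_set (eps_pow n%:R) B u ->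
  (disk_gauge B u < r%:E)%E.
Proof.
move=> r0; exists (Num.truncn `|ln r|).+1 => B n u dB Nn Bu.
apply: (le_lt_trans (disk_gauge_le Bu)); rewrite lte_fin -[ltRHS](lnK r0).
rewrite ltr_expR ltrNl (@lt_le_trans _ _ (Num.truncn `|ln r|).+1%:R)//.
  by rewrite (le_lt_trans _ (truncnS_gt _))// -normrN ler_norm.
by rewrite ler_nat.
Qed.

(** Completeness of the gauge, for sequences with prescribed increments.  The
    gauge is only finite on the span of B, but the differences x n - x 0 lie
    there, so that a sequence anywhere in G may be translated into the span.
    The limit stays in the ball around x n since dilates of a disk are additive
    subgroups, hence closed for the gauge. *)
Lemma disk_complete_limit B (x : nat -> G) (s : nat -> R) :
  disk B -> disk_complete B ->
  (forall n, s n <= s n.+1) -> (forall n, n%:R <= s n) ->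
  (forall n, scale_set (eps_pow (s n)) B (x n.+1 - x n)) ->
  exists l, forall n, scale_set (eps_pow (s n)) B (l - x n).
Proof.
move=> dB cB s_incr s_ge dx.
have s_homo m n : (m <= n)%N -> s m <= s n.
  by move: m n; apply: (@homo_leq _ s <=%R) => [//|y ? ?|//]; exact: le_trans.
have dxm n m : (n <= m)%N -> scale_set (eps_pow (s n)) B (x m - x n).
  move=> nm; rewrite -(telescope_sumr x nm); apply: disk_sum.
    exact: disk_eps_ball.
  by move=> k nk; apply: eps_ball_le (dx k) => //; exact: s_homo.
have [||l _ xl] := cB (fun n => x n - x 0%N).
(* x n - x 0 lies in B itself, the dilate of exponent 0 in the span. *)
- move=> n; exists 0%N => //; rewrite oppr0.
  exact: (eps_ball_le dB (s_ge 0%N)) (dxm 0%N n _).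
- move=> r /disk_gauge_small[N rN]; exists N => m n Nm Nn.
  apply: (rN B N) => //; rewrite opprB subrKA.
  rewrite -(subrKA (x N)) -(opprB (x n)).
  by apply: diskB; [exact: disk_eps_ball|
    exact/(eps_ball_le dB (s_ge N))/dxm..].
exists (l + x 0%N) => n.
have [N lN] := xl _ (expR_gt0 (- s n)).
have := disk_gauge_lt dB (lN _ (leq_maxr n N)).
have := dxm _ _ (leq_maxl n N); set p := maxn n N => hn hl.
have := diskB (disk_eps_ball _ dB) hn hl.
by rewrite !opprB addrC [l + (_ - _)]addrA subrKA.
Qed.

End Disks.

(** * Baire category with respect to a Banach disk *)

Section Baire.
Variables (R : realType) (F : topologicalGmodType (gennum R)).
Implicit Types (B M : set F) (s t : R) (u v : F).

(** The centre v ranges over all of F and not only over the span of B: F is a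
    disjoint union of translates of this span, so that every set can be tested
    as it is, without being intersected with the span. *)
Definition disk_dense_at B M s v := forall u t,
  scale_set (eps_pow s) B (u - v) ->
  exists2 w, M w & scale_set (eps_pow t) B (u - w).

Definition disk_nowhere_dense B M := forall v s, ~ disk_dense_at B M s v.

Definition disk_meagre B M := exists2 N : nat -> set F,
  (forall n, disk_nowhere_dense B (N n)) & M `<=` \bigcup_n N n.

Lemma disk_nowhere_dense0 B : disk B -> disk_nowhere_dense B set0.
Proof.
move=> dB v s /(_ v 0); rewrite subrr; case=> //.
exact: disk0 (disk_eps_ball _ dB).
Qed.

Lemma disk_meagre_bigcup B (M : nat -> set F) : disk B ->
  (forall n, disk_meagre B (M n)) -> disk_meagre B (\bigcup_n M n).
Proof.
move=> dB mM; have [N Nnd MN] : exists2 N : nat -> nat -> set F,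
    (forall n k, disk_nowhere_dense B (N n k)) &
    (forall n, M n `<=` \bigcup_k N n k).
  by case: (choice (fun n => let: ex_intro2 N a b := mM n in
                      ex_intro (fun N => _ /\ _) N (conj a b))) => N HN;
     exists N => n; case: (HN n).
exists (fun i => if unpickle i is Some nk then N nk.1 nk.2 else set0) => [i|u].
  case: unpickle => [[n k]|]; first exact: Nnd.
  exact: disk_nowhere_dense0.
case=> n _ /MN[k _ Nu]; exists (pickle (n, k)) => //.
by rewrite pickleK.
Qed.

(** Baire's theorem: nested balls q n, the (n+1)-st of which misses the n-th
    nowhere dense set, shrink to a point that lies in none of these sets. *)
Lemma disk_Baire B : disk B -> disk_complete B -> ~ disk_meagre B [set: F].
Proof.
move=> dB cB [N Nnd Nall].
have avoid (n : nat) (p : F * R) : exists q : F * R,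
    [/\ scale_set (eps_pow p.2) B (q.1 - p.1), p.2 <= q.2, n.+1%:R <= q.2 &
     forall w, scale_set (eps_pow q.2) B (w - q.1) -> ~ N n w].
  have /existsNP[u /existsNP[t /not_implyP[pu Nu]]] := Nnd n p.1 p.2.
  exists (u, Num.max (Num.max p.2 t) n.+1%:R); split=> //=.
  - by rewrite le_max le_max lexx.
  - by rewrite le_max lexx orbT.
  - move=> w uw Nw; apply: Nu; exists w => //.
    rewrite -opprB; apply: diskN; first exact: disk_eps_ball.
    by apply: eps_ball_le uw => //; rewrite !le_max lexx orbT.
have [f fP] := choice (fun np : nat * (F * R) => avoid np.1 np.2).
pose q := fix q n := if n is m.+1 then f (m, q m) else (0, 0).
have [|||l lq] := @disk_complete_limit _ _ B (fst \o q) (snd \o q) dB cB.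
- by move=> n; have [] := fP (n, q n).
- by case=> [|n]; [exact: lexx|have [] := fP (n, q n)].
- by move=> n; have [] := fP (n, q n).
have [n _ Nl] := Nall l I.
by have [_ _ _ /(_ l (lq n.+1))] := fP (n, q n); apply.
Qed.

(** A nonmeagre set is not nowhere dense, hence dense in some ball; and since
    every point of a ball of an ultrametric is a centre of it, the centre may be
    taken in the set itself. *)
Lemma disk_nonmeagre_dense B M : disk B -> ~ disk_meagre B M ->
  exists s z, M z /\ disk_dense_at B M s z.
Proof.
move=> dB Mnm; apply: contrapT => Mnd; apply: Mnm.
exists (fun=> M) => [_ v s Md|u Mu]; last by exists 0%N.
apply: Mnd; have [|z Mz vz] := Md v s.
  by rewrite subrr; exact: disk0 (disk_eps_ball _ dB).
exists s, z; split=> // u t uz; apply: Md.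
rewrite -(subrKA z) -(opprB v); apply: diskB => //.
exact: disk_eps_ball.
Qed.

End Baire.

(** * Neighbourhoods of 0 *)

Section Neighborhoods.
Variables (R : realType) (G : topologicalGmodType (gennum R)).
Implicit Types (U V : set G) (u v : G).

Lemma continuous_addr v : continuous (fun u : G => u + v).
Proof.
by move=> u; apply: (cvg_comp2 cvg_id (cvg_cst v) (gmod_add_continuous (u, v))).
Qed.

Lemma continuous_scaler (c : gennum R) : continuous (fun u : G => c *: u).
Proof.
move=> u.
by apply: (cvg_comp2 (cvg_cst c) cvg_id (gmod_scale_continuous (c, u))).
Qed.

Lemma continuous_scalel v : continuous (fun c : gennum R => c *: v).
Proof.
move=> c.
by apply: (cvg_comp2 cvg_id (cvg_cst v) (gmod_scale_continuous (c, v))).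
Qed.

Lemma gmod_cvgB (x y : nat -> G) u v :
  x @ \oo --> u -> y @ \oo --> v -> (fun n => x n - y n) @ \oo --> u - v.
Proof.
move=> xu yv.
have yv' : (fun n => -1 *: y n) @ \oo --> -1 *: v.
  exact: (cvg_comp y (fun u => -1 *: u) yv (@continuous_scaler (-1) v)).
have -> : (fun n => x n - y n) = (fun n => x n + -1 *: y n).
  by apply/funext => n; rewrite scaleN1r.
rewrite -scaleN1r.
exact: (cvg_comp2 xu yv' (gmod_add_continuous (u, -1 *: v))).
Qed.

Lemma nbhs_gmod_shift U u : nbhs 0 U -> nbhs u [set v | U (v - u)].
Proof. by move=> U0; apply: (@continuous_addr (- u) u U); rewrite /= subrr. Qed.

Lemma nbhs_gmod_unshift U u : nbhs u U -> nbhs 0 [set v | U (v + u)].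
Proof. by move=> U0; apply: (@continuous_addr u 0 U); rewrite /= add0r. Qed.

Lemma nbhs0_gennum (A : set (gennum R)) : nbhs 0 A ->
  exists2 d : R, 0 < d & forall x, gabs x < d -> A x.
Proof.
move=> /nbhs_ballP[d d0 dA]; exists d => // x xd; apply: dA.
by rewrite /ball/= sub0r gabsN.
Qed.

(** Neighbourhoods of 0 are absorbent, because c *: v tends to 0 with c. *)
Lemma nbhs0_absorbent V v : nbhs 0 V ->
  exists m : nat, scale_set (eps_pow (- m%:R)) V v.
Proof.
move=> V0; have : nbhs (0 : gennum R) [set c | V (c *: v)].
  by apply: (@continuous_scalel v 0 V); rewrite /= scale0r.
move=> /nbhs0_gennum[d d0 dV]; have [a ad] := @gabs_eps_pow_small R _ d0.
exists (Num.truncn `|a|).+1; apply/eps_ballP; rewrite opprK; apply: dV.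
rewrite -[eps_pow _]mul1r; apply: ad; first exact: gabs1.
by rewrite (le_trans (ler_norm a))// ltW// truncnS_gt.
Qed.

(** Convex neighbourhoods need not be balanced, but the balanced core V of a
    convex neighbourhood W is still convex, and is still a neighbourhood of 0 by
    joint continuity of the scalar multiplication at (0, 0). *)
Lemma glocally_convex_disk U : glocally_convex G -> nbhs 0 U ->
  exists V, [/\ disk V, nbhs 0 V & V `<=` U].
Proof.
move=> [BG BGnbhs BGbase] /BGbase[W /BGnbhs[[WD Weps] W0] WU].
pose V : set G := [set v | forall l : gennum R, gabs l <= 1 -> W (l *: v)].
exists V; split; last by move=> v /(_ 1 (@gabs1 R)); rewrite scale1r => /WU.
- split.
  + by exists 0 => l _; rewrite scaler0; exact: nbhs_singleton.
  + move=> l l1 _ [v Vv <-] k k1; rewrite scalerA; apply: Vv.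
    exact: gabsM_le1.
  + split.
      move=> _ [u Vu [v Vv <-]] l l1; rewrite scalerDr; apply: WD.
      by exists (l *: u); [exact: Vu|exists (l *: v); [exact: Vv|]].
    move=> b b0 _ [v Vv <-] l l1; rewrite scalerA mulrC -scalerA.
    by apply: Weps b0 _ _; exists (l *: v) => //; exact: Vv.
- have : nbhs ((0, 0) : gennum R * G) [set z | W (z.1 *: z.2)].
    by apply: (@gmod_scale_continuous _ G (0, 0) W); rewrite /= scaler0.
  move=> [[A D] /= [/nbhs0_gennum[d d0 dA] D0] ADW].
  have [a ad] := @gabs_eps_pow_small R _ d0.
  have : nbhs 0 [set v | D (eps_pow (- a) *: v)].
    by apply: (@continuous_scaler (eps_pow (- a)) 0 D); rewrite /= scaler0.
  apply: filterS => v Dv l l1.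
  (* l *: v = (l eps^a) *: (eps^-a *: v), the product of two small factors. *)
  have := ADW (l * eps_pow a, eps_pow (- a) *: v); rewrite /= scalerA -mulrA.
  rewrite -eps_powD subrr eps_pow0 mulr1; apply; split => //.
  exact/dA/ad.
Qed.

(** A disk that is a neighbourhood of 0 is an open subgroup, hence closed. *)
Lemma disk_closed_limit V (x : nat -> G) l : disk V -> nbhs 0 V ->
  (forall n, V (x n)) -> x @ \oo --> l -> V l.
Proof.
move=> dV V0 Vx xl.
have [n _ /(_ n (leqnn n)) Vxl] := xl _ (nbhs_gmod_shift l V0).
by rewrite -[l](subKr (x n)); exact: diskB.
Qed.

(** On a bounded disk, convergence for the gauge implies convergence for the
    topology of the module. *)
Lemma bounded_eps_ball_cvg0 (B : set G) (s : nat -> R) (x : nat -> G) :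
  disk B -> gbounded B -> (forall n, n%:R <= s n) ->
  (forall n, scale_set (eps_pow (s n)) B (x n)) -> x @ \oo --> 0.
Proof.
move=> dB bB s_ge Bx U /bB[a aU]; rewrite near_simpl.
exists (Num.truncn `|a|).+1 => // n /= an.
have /eps_ballP Bn := eps_ball_le dB (s_ge n) (Bx n).
have [|v Uv vx] := aU (- n%:R) _ _ Bn; last first.
  suff <- : v = x n by [].
  have := congr1 (fun w => eps_pow n%:R *: w) vx.
  by rewrite /= !scalerA -eps_powD subrr eps_pow0 !scale1r.
rewrite lerNl (le_trans _ (_ : (Num.truncn `|a|).+1%:R <= _))//; last first.
  by rewrite ler_nat.
by rewrite ltW// (le_lt_trans _ (truncnS_gt _))// -normrN ler_norm.
Qed.

End Neighborhoods.

(** * Branches of a web *)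

Section Webs.
Variables (R : realType) (G F : topologicalGmodType (gennum R)).

(** A set covered by countably many pieces has a nonmeagre piece when it is
    nonmeagre itself; iterating this along the layers of the web selects the
    branch. *)
Lemma nonmeagre_branch (f : G -> F) (C : seq nat -> set G) (W : set G)
    (B : set F) :
  is_web C -> disk B -> ~ disk_meagre B (f @` W) ->
  exists2 n : nat -> nat, (forall k, (0 < k)%N -> (0 < n k)%N) &
    forall k, (0 < k)%N ->
      ~ disk_meagre B (f @` (C [seq n i | i <- iota 1 k] `&` W)).
Proof.
move=> [C1 C2] dB Wnm.
(* The root of the web, at which the value of C is arbitrary, stands for G. *)
pose D s := if s is [::] then [set: G] else C s.
have DE s : all (fun n => 0 < n)%N s ->
    D s = \bigcup_(n in [set n : nat | (0 < n)%N]) D (rcons s n).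
  case: s => [_ //|a s sp]; exact: C2.
pose good s := all (fun n => 0 < n)%N s /\ ~ disk_meagre B (f @` (D s `&` W)).
have ext s : exists n, good s -> (0 < n)%N /\ good (rcons s n).
  have [gs|] := pselect (good s); last by exists 0%N.
  apply: contrapT => next; have [sp] := gs; apply.
  suff -> : f @` (D s `&` W) =
      \bigcup_n (if (0 < n)%N then f @` (D (rcons s n) `&` W) else set0).
    apply: disk_meagre_bigcup => // n; apply: contrapT => nm; apply: next.
    exists n => _; case: n nm => [|n] nm; last first.
      by split => //; split; rewrite // all_rcons sp.
    case: nm; exists (fun=> set0) => //.
    by move=> _; exact: disk_nowhere_dense0.
  rewrite DE//; apply/seteqP; split=> [_ [x [[n n0 Dx] Wx] <-]|u [n _]].
    by exists n => //=; rewrite n0; exists x.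
  by case: ifPn => // n0 [x [Dx Wx] <-]; exists x => //; split=> //; exists n.
have [g gP] := choice ext.
(* S k is the initial segment of length k of the branch. *)
pose S := fix S k := if k is k'.+1 then rcons (S k') (g (S k')) else [::].
have goodS k : good (S k).
  elim: k => [|k IH]; last by have [] := gP _ IH.
  by split; rewrite //= setTI.
exists (fun i => g (S i.-1)) => [[//|k] _|k k0].
  by have [] := gP _ (goodS k).
suff -> : [seq g (S i.-1) | i <- iota 1 k] = S k.
  have [_] := goodS k; rewrite /D; case: k k0 => //= k _.
  by case: (rcons _ _) (size_rcons (S k) (g (S k))).
elim: k {k0} => // k IH.
by rewrite -[X in iota 1 X]addn1 iotaD map_cat IH /= cats1.
Qed.

End Webs.

(** * The open mapping theorem *)

Section OpenMapping.
Variables (R : realType) (G F : topologicalGmodType (gennum R)).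
Variable T : {linear G -> F}.
Implicit Types (A V : set G) (B : set F).

(** One step of the successive approximation: T z + eps^-a r lies in the ball
    T z + B_s, where T(A) is dense, and is therefore close to some T x. *)
Lemma disk_dense_approx A B (s a t : R) (z : G) (r : F) :
  disk_dense_at B (T @` A) s (T z) -> scale_set (eps_pow (a + s)) B r ->
  exists2 x, A x & scale_set (eps_pow t) B
    (r - (T (eps_pow a *: x) - T (eps_pow a *: z))).
Proof.
move=> dT /(eps_ball_scale (- a)); rewrite addKr => Br.
have [|_ [x Ax <-] Bx] := dT (T z + eps_pow (- a) *: r) (- a + t).
  by rewrite addrAC subrr add0r.
exists x => //; have := eps_ball_scale a Bx; rewrite addNKr; congr scale_set.
rewrite !linearZ /= scalerBr scalerDr scalerA -eps_powD subrr eps_pow0 scale1r.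
by rewrite scalerN opprB [_ + r]addrC addrA.
Qed.

Lemma disk_image V : disk V -> disk (T @` V).
Proof.
move=> dV; have [_ bal [_ cvx]] := dV; split.
- by exists (T 0), 0 => //; exact: disk0.
- move=> l l1 _ [_ [v Vv <-] <-]; exists (l *: v); last by rewrite linearZ.
  by apply: (bal l) => //; exists v.
- split.
    move=> _ [_ [u Vu <-] [_ [v Vv <-] <-]]; exists (u + v).
      exact: diskD.
    by rewrite linearD.
  move=> b b0 _ [_ [v Vv <-] <-].
  exists (eps_pow b *: v); last by rewrite linearZ.
  by apply: (cvx b) => //; exists v.
Qed.

(** The heart of the proof: w is the image of the difference of two sums of
    series along a branch of the web, both lying in V. *)
Lemma image_contains_eps_ball (C : seq nat -> set G) V B :
  is_web C -> web_typeC C -> sequentially_closed_map T ->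
  set_surj [set: G] [set: F] T -> disk V -> nbhs 0 V ->
  gbounded B -> banach_disk B -> exists a, scale_set (eps_pow a) B `<=` T @` V.
Proof.
move=> webC typeC Tclosed Tonto dV V0 bB [dB _ cB].
pose W (m : nat) := scale_set (eps_pow (- m%:R)) V.
have [m Wnm] : exists m, ~ disk_meagre B (T @` W m).
  apply: contrapT => /forallNP Wm; apply: (disk_Baire dB cB).
  suff -> : [set: F] = \bigcup_m T @` W m.
    by apply: disk_meagre_bigcup => // m; exact: contrapT (Wm m).
  apply/seteqP; split=> // y _; have [x _ <-] := Tonto y I.
  by have [m Wx] := nbhs0_absorbent x V0; exists m => //; exists x.
have [n n_gt0 nP] := nonmeagre_branch webC dB Wnm.
pose A k := C [seq n i | i <- iota 1 k] `&` W m.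
have /choice[sz szP] k : exists sz : R * G, (0 < k)%N ->
    A k sz.2 /\ disk_dense_at B (T @` A k) sz.1 (T sz.2).
  have [k0|] := boolP (0 < k)%N; last by exists (0, 0).
  have [s [_ [[z Az <-] zd]]] := disk_nonmeagre_dense dB (nP k k0).
  by exists (s, z).
pose s k := (sz k).1; pose z k := (sz k).2.
have [rho rhoP] := typeC n n_gt0.
(* The three terms give, in this order, convergence of the series, terms in V,
   and remainders tending to 0. *)
pose a k := Num.max (rho k) (Num.max m%:R (k%:R - s k)).
have rho_a k : rho k <= a k by rewrite le_max lexx.
have m_a k : m%:R <= a k by rewrite !le_max lexx orbT.
have s_a k : k%:R <= a k + s k by rewrite -lerBlDr !le_max lexx !orbT.
exists (a 1%N + s 1%N) => w Bw.
have /choice[h hP] (kr : nat * F) : exists x, (0 < kr.1)%N ->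
    scale_set (eps_pow (a kr.1 + s kr.1)) B kr.2 ->
    A kr.1 x /\ scale_set (eps_pow (a kr.1.+1 + s kr.1.+1)) B
      (kr.2 - (T (eps_pow (a kr.1) *: x) - T (eps_pow (a kr.1) *: z kr.1))).
  case: kr => k r /=; have [k0|] := boolP (0 < k)%N; last by exists 0.
  have [Br|] := pselect (scale_set (eps_pow (a k + s k)) B r); last by exists 0.
  have [x Ax Bx] := disk_dense_approx (a k.+1 + s k.+1) (szP k k0).2 Br.
  by exists x.
(* The remainder r k lies in B_(a (k+1) + s (k+1)) since indices start at 1. *)
pose r := fix r k := if k is k'.+1 then
    r k' - (T (eps_pow (a k) *: h (k, r k')) - T (eps_pow (a k) *: z k))
  else w.
pose x k := h (k, r k.-1).
have rB k : scale_set (eps_pow (a k.+1 + s k.+1)) B (r k).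
  by elim: k => [//|k IH]; have [] := hP (k.+1, r k) isT IH.
have xA k : (0 < k)%N -> A k (x k).
  by case: k => // k _; have [] := hP (k.+1, r k) isT (rB k).
have zA k : (0 < k)%N -> A k (z k) by move=> /szP[].
have partial_limit (y : nat -> G) : (forall k, (0 < k)%N -> A k (y k)) ->
    exists2 l, V l &
      (\sum_(1 <= k < N.+1) eps_pow (a k) *: y k) @[N --> \oo] --> l.
  move=> yA; have [|l yl] := rhoP a y (fun k _ => rho_a k).
    by move=> k /yA[].
  exists l => //; apply: (disk_closed_limit dV V0 _ yl) => N.
  apply: disk_sum => // k /yA[_ /(eps_ball_scale (a k)) Vy].
  have /eps_ballP : scale_set (eps_pow 0) V (eps_pow (a k) *: y k).
    by apply: eps_ball_le Vy => //; rewrite subr_ge0.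
  by rewrite oppr0 eps_pow0 scale1r.
have [lx Vx xl] := partial_limit x xA.
have [lz Vz zl] := partial_limit z zA.
exists (lx - lz); first exact: diskB.
have r0 : r @ \oo --> 0.
  apply: (bounded_eps_ball_cvg0 dB bB _ rB) => k.
  by apply: le_trans (s_a k.+1); rewrite ler_nat.
pose p N := \sum_(1 <= k < N.+1) eps_pow (a k) *: x k -
            \sum_(1 <= k < N.+1) eps_pow (a k) *: z k.
have Tp N : T (p N) = w - r N.
  elim: N => [|N IH]; first by rewrite /p !big_geq// subrr linear0 subrr.
  rewrite /p !(@big_nat_recr _ _ _ N.+1)//= opprD addrACA linearD -/(p N) IH.
  by rewrite -addrA linearB opprB [- r N + _]addrC.
have pl : p @ \oo --> lx - lz by exact: gmod_cvgB xl zl.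
have Tpl : (fun N => T (p N)) @ \oo --> w.
  rewrite -[w]subr0; under eq_fun do rewrite Tp.
  exact: (gmod_cvgB (cvg_cst w) r0).
exact/esym/(Tclosed (fun N => (p N, T (p N))) (lx - lz, w) (fun=> erefl)
              (cvg_pair pl Tpl)).
Qed.

Lemma ultrabornivorous_image (C : seq nat -> set G) V :
  is_web C -> web_typeC C -> sequentially_closed_map T ->
  set_surj [set: G] [set: F] T -> disk V -> nbhs 0 V ->
  ultrabornivorous (T @` V).
Proof.
move=> webC typeC Tclosed Tonto dV V0 B bB BB.
have [a aV] := image_contains_eps_ball webC typeC Tclosed Tonto dV V0 bB BB.
have [dB _ _] := BB.
exists (- a) => b ba u Bu; apply/eps_ballP/aV.
apply: (@eps_ball_le _ _ B a (- b) dB); first by rewrite lerNr.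
by exists u.
Qed.

End OpenMapping.

Theorem theorem2p3 (R : realType) (G F : topologicalGmodType (gennum R))
    (hG : glocally_convex G)
    (hweb : exists2 C : seq nat -> set G, is_web C & web_typeC C)
    (hF : hausdorff_space F)
    (hF' : ultrabornological F)
    (T : {linear G -> F})
    (hTclosed : sequentially_closed_map T)
    (hTonto : set_surj [set: G] [set: F] T) :
  open_map T.
Proof.
have [C webC typeC] := hweb.
move=> U oU; rewrite openE => _ [x Ux <-]; rewrite /interior.
have [V [dV V0 VU]] :=
  glocally_convex_disk hG (nbhs_gmod_unshift (open_nbhs_nbhs (conj oU Ux))).
have [_ TVbal TVcvx] := disk_image T dV.
have TV0 : nbhs 0 (T @` V).
  apply: hF'.2; first by split.
  exact: ultrabornivorous_image webC typeC hTclosed hTonto dV V0.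
apply: filterS (nbhs_gmod_shift (T x) TV0) => y [v /VU Uv Tv].
by exists (v + x); rewrite // linearD Tv subrK.
Qed.
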